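(* Let $R(p) := 1 + \frac{1}{4}p^2+\frac{1}{2}p(1-p) + \frac{9}{64}p^{4}+ \frac{9}{16}p^{3}(1-p)+\frac{3}{8} p^2(1-p)^2$, and let $p_1 = 0.7805\dots$ denote the root in $(0,1)$ of the equation $\pi p\sqrt{3-2p}\,R(p) = 4$. If $p > p_1$, then for every sequence of instructions and every location $x_{\mathrm{home}} \in \mathbb{Z}^2\setminus\{0\}$ of home, the hitting time $T$ of the guided random walk satisfies $\mathbb{E}[T] = \infty$.
   Context: Fix $p\in[0,1]$. A sequence of instructions is an infinite walk $(x_t)_{t\ge 0}$ in $\mathbb{Z}^2$ with $x_0=0$ and $x_{t+1}-x_t\in\{(\pm1,0),(0,\pm1)\}$; it may depend on the location $x_{\mathrm{home}}\in\mathbb{Z}^2$ of home. The guided random walk following these instructions is the Markov chain $(X_t)_{t\ge0}$ with $X_0=0$ and, independently at each step, $X_{t+1}-X_t = x_{t+1}-x_t$ with probability $1-p$, and $X_{t+1}-X_t$ uniformly distributed on $\{(\pm1,0),(0,\pm1)\}$ with probability $p$. The hitting time is $T:=\inf\{t\ge 0 : X_t = x_{\mathrm{home}}\}$. *)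

(* Defs.v *)
From HB Require Import structures.
From mathcomp Require Import all_boot all_order all_algebra.
From mathcomp Require Import all_classical all_reals all_analysis.
Set Implicit Arguments. Unset Strict Implicit. Unset Printing Implicit Defensive.
Import Order.TTheory GRing.Theory Num.Theory.
Local Open Scope ring_scope.

Definition pt := (int * int)%type.
Definition psub (a b : pt) : pt := (a.1 - b.1, a.2 - b.2).
Definition origin : pt := (0, 0).

Definition dir (e : 'I_4) : pt :=
  match val e with
  | 0%N => (1, 0) | 1%N => (-1, 0) | 2%N => (0, 1) | _ => (0, -1)
  end.
Definition unit_step (v : pt) : bool := [exists e : 'I_4, v == dir e].

Definition instructions (x : nat -> pt) : Prop :=
  x 0%N = origin /\ forall t, unit_step (psub (x t.+1) (x t)).

(* probability that the actual step is [actual] when the instructed step is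
   [instr]: follow with prob 1-p, otherwise uniform among the 4 steps *)
Definition step_prob {R : realType} (p : R) (instr actual : pt) : R :=
  (if actual == instr then 1 - p else 0) + p / 4.

Definition pos (t : nat) (e : {ffun 'I_t -> 'I_4}) (s : nat) : pt :=
  (\sum_(i < t | (i < s)%N) (dir (e i)).1, \sum_(i < t | (i < s)%N) (dir (e i)).2).

Definition path_prob {R : realType} (p : R) (x : nat -> pt) (t : nat)
    (e : {ffun 'I_t -> 'I_4}) : R :=
  \prod_(i < t) step_prob p (psub (x i.+1 ) (x i)) (dir (e i)).

Definition hit_prob {R : realType} (p : R) (x : nat -> pt) (home : pt) (t : nat) : R :=
  \sum_(e : {ffun 'I_t -> 'I_4} |
          (pos e t == home) && [forall s : 'I_t, pos e s != home])
    path_prob p x e.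

(* E[T] in the extended reals: sum_t t P(T=t) + oo * P(T = oo),
   with P(T = oo) = 1 - sum_t P(T = t). *)
Definition expected_hitting_time {R : realType} (p : R) (x : nat -> pt) (home : pt)
  : \bar R :=
  ((\sum_(0 <= t <oo) ((t%:R * hit_prob p x home t)%:E)) +
   (+oo * (1%:E - \sum_(0 <= t <oo) (hit_prob p x home t)%:E)))%E.

Definition Rpoly {R : realType} (p : R) : R :=
  1 + 4^-1 * p ^+ 2 + 2^-1 * p * (1 - p) + (9 / 64) * p ^+ 4
  + (9 / 16) * p ^+ 3 * (1 - p) + (3 / 8) * p ^+ 2 * (1 - p) ^+ 2.

(* Main.v *)
(* A visit to home at time t is followed by returns at times t + 2 and t + 4 with
   probability at least r2 and r4, whatever the instructions are, and
   1 + r2 + r4 = R(p).  Hence R(p) P(t < T <= t + n) is at most the expected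
   number of visits to home in (t, t + n + 4] on the event T > s, for every
   s < t.  By a local limit bound, uniform in the instructions, this event
   contributes at most P(T > s) c / (t - s) at each time of the right parity,
   for any c > 2 / (pi p sqrt (3 - 2 p)) and t - s large; the worst case is a
   walk instructed always along one axis.  With S(t) = P(T > t) this reads
     - S'(t) <= b S(s) / (t - s) for all s < t, with b = c / (2 R(p)).
   Taking s = t / 2, if t S(t) is nondecreasing up to time t then
   - S'(t) <= 4 b S(t) / t, and 4 b < 1 exactly when p > p_1, so t S(t) keeps
   increasing.  The induction starts because a walk that has first escaped to a
   large distance of home has S = 1 for a long time.  So t S(t) does not tend to
   0, which is impossible if E[T] is finite. *)
Require Import Defs.
From HB Require Import structures.
From mathcomp Require Import all_boot all_order all_algebra.
From mathcomp Require Import all_classical all_reals all_analysis.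
From mathcomp Require Import measurable_realfun ring lra zify.
Import Order.TTheory GRing.Theory Num.Theory.
Import numFieldNormedType.Exports.
Local Open Scope ring_scope.

Set Implicit Arguments. Unset Strict Implicit. Unset Printing Implicit Defensive.

(** * The walk *)

Section Walk.
Context {R : realType} (p : R).
Implicit Types (w : nat -> 'I_4) (z : pt) (d e : 'I_4) (s t n : nat).

Definition stp (e d : 'I_4) : R := (if d == e then 1 - p else 0) + p / 4.

Definition later w : nat -> 'I_4 := fun n => w n.+1.

(** The target moves while the walker stays at the origin, so unfolding a first step changes only
    the instructions and the target, over which the inductions generalise. *)
Definition after z d : pt := psub z (dir d).

(* [prb w z n] is P(X_n = z), [hit w z t] is P(T = t) and [surv w z t] is
   P(T > t), where T is the hitting time of z; [vis w z s n] is
   P(T > s, X_(s+n) = z). *)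
Fixpoint prb w z n : R :=
  if n is m.+1 then \sum_d stp (w 0%N) d * prb (later w) (after z d) m
  else (z == origin)%:R.

Fixpoint hit w z t : R :=
  if t is m.+1 then
    if z == origin then 0
    else \sum_d stp (w 0%N) d * hit (later w) (after z d) m
  else (z == origin)%:R.

Fixpoint surv w z t : R :=
  if z == origin then 0
  else if t is m.+1 then \sum_d stp (w 0%N) d * surv (later w) (after z d) m
  else 1.

Fixpoint vis w z s n : R :=
  if z == origin then 0
  else if s is m.+1 then \sum_d stp (w 0%N) d * vis (later w) (after z d) m n
  else prb w z n.

Hypotheses (p_gt0 : 0 < p) (p_le1 : p <= 1).

Lemma stp_ge0 e d : 0 <= stp e d.
Proof. by rewrite /stp; case: eqP => _; have := p_gt0; have := p_le1; lra. Qed.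

Lemma sum_stp e : \sum_d stp e d = 1.
Proof.
rewrite big_split /= sumr_const card_ord -big_mkcond big_pred1_eq.
by rewrite -mulr_natr; field.
Qed.

Lemma sum_stpE (F : 'I_4 -> R) e :
  \sum_d stp e d * F d = (1 - p) * F e + p / 4 * \sum_d F d.
Proof.
under eq_bigr do rewrite mulrDl.
rewrite big_split /= mulr_sumr; congr (_ + _).
rewrite (bigD1 e) //= eqxx big1 ?addr0 // => i /negPf ->; exact: mul0r.
Qed.

Lemma ler_stp e d x y : x <= y -> stp e d * x <= stp e d * y.
Proof. exact/ler_wpM2l/stp_ge0. Qed.

Lemma ler_sum_stp {F G : 'I_4 -> R} e :
  (forall d, F d <= G d) -> \sum_d stp e d * F d <= \sum_d stp e d * G d.
Proof. by move=> FG; apply: ler_sum => d _; exact: ler_stp. Qed.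

Lemma sum_stp_ge0 {F : 'I_4 -> R} e :
  (forall d, 0 <= F d) -> 0 <= \sum_d stp e d * F d.
Proof. by move=> F0; apply: sumr_ge0 => d _; exact/mulr_ge0/F0/stp_ge0. Qed.

Lemma prb_ge0 w z n : 0 <= prb w z n.
Proof. elim: n w z => [|n IH] w z /=; [exact: ler0n | exact: sum_stp_ge0]. Qed.

Lemma hit_ge0 w z t : 0 <= hit w z t.
Proof.
elim: t w z => [|t IH] w z /=; first exact: ler0n.
by case: ifP => // _; exact: sum_stp_ge0.
Qed.

Lemma surv_ge0 w z t : 0 <= surv w z t.
Proof.
elim: t w z => [|t IH] w z /=; case: ifP => // _; exact: sum_stp_ge0.
Qed.

Lemma hitD_surv w z t : surv w z t.+1 + hit w z t.+1 = surv w z t.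
Proof.
elim: t w z => [|t IH] w z; last first.
  rewrite [surv _ _ _]/= [hit _ _ _]/= [RHS]/=; case: ifP => _; first by rewrite addr0.
  by rewrite -big_split; apply: eq_bigr => d _ /=; rewrite -mulrDr -IH.
rewrite /=; case: ifP => _; first by rewrite addr0.
rewrite -big_split -[RHS](sum_stp (w 0%N)); apply: eq_bigr => d _ /=.
by case: ifP => _; rewrite /= ?(addr0, add0r, mulr0, mulr1).
Qed.

Lemma surv0 w z : surv w z 0 + hit w z 0 = 1.
Proof. by rewrite /=; case: ifP => _; rewrite ?addr0 ?add0r. Qed.

Lemma sum_hit w z t : surv w z t + \sum_(s < t.+1) hit w z s = 1.
Proof.
elim: t => [|t IH]; first by rewrite big_ord_recl big_ord0 addr0 surv0.
by rewrite big_ord_recr /= addrCA addrC -[RHS]IH -(hitD_surv w z t) addrAC addrC addrA.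
Qed.

Lemma sum_hit_ivl w z s n :
  \sum_(i < n) hit w z (s + i.+1)%N = surv w z s - surv w z (s + n)%N.
Proof.
elim: n => [|n IH]; first by rewrite big_ord0 addn0 subrr.
by rewrite big_ord_recr /= IH addnS -(hitD_surv w z (s + n)); ring.
Qed.

Definition nz (z : pt) : bool := odd (`|z.1| + `|z.2|)%N.

Lemma nz_after z d : nz (after z d) = ~~ nz z.
Proof.
rewrite /nz /after /psub /dir /=; case: z => a b /=.
have A1 (x : int) : odd (absz (x - 1)%R) = ~~ odd (absz x) by lia.
have A2 (x : int) : odd (absz (x - (- 1))%R) = ~~ odd (absz x) by lia.
by case: d => [[|[|[|[|]]]] ?] //=; rewrite !oddD ?subr0 ?A1 ?A2 ?addNb ?addbN.
Qed.

Lemma prb_parity w z n : nz z != odd n -> prb w z n = 0.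
Proof.
elim: n w z => [|n IH] w z /=; first by case: (z =P origin) => [->|].
move=> h; rewrite big1 // => d _; rewrite IH ?mulr0 // nz_after.
by case: (nz z) h; case: odd.
Qed.

(** Parity makes one of the two terms vanish, so two consecutive times cost [c] instead of [2 * c].
    The factor 2 dividing the hazard coefficient comes from here. *)
Lemma prb_pair w z n (c : R) :
  (forall w z, prb w z n <= c) -> (forall w z, prb w z n.+1 <= c) ->
  prb w z n + prb w z n.+1 <= c.
Proof.
move=> c0 c1; have [h|h] := eqVneq (nz z) (odd n).
  by rewrite (@prb_parity w z n.+1) ?addr0 // h /=; case: odd.
by rewrite prb_parity // add0r.
Qed.

Lemma vis_pair w z s n (c : R) :
  (forall w z, prb w z n <= c) -> (forall w z, prb w z n.+1 <= c) ->
  vis w z s n + vis w z s n.+1 <= surv w z s * c.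
Proof.
move=> c0 c1; elim: s w z => [|s IH] w z.
  by rewrite /=; case: ifP => _; rewrite ?addr0 ?mul0r // mul1r; exact: prb_pair.
rewrite [vis _ _ _ _]/= [vis _ _ _ n.+1]/= [surv _ _ _]/=.
case: ifP => _; first by rewrite addr0 mul0r.
rewrite -big_split mulr_suml; apply: ler_sum => d _ /=.
by rewrite -mulrDr -mulrA; exact/ler_stp/IH.
Qed.

(** * Visits to home against first hits *)

Section Visits.
Context (r2 r4 : R).
Hypothesis r2_le : forall w, r2 <= prb w origin 2.
Hypothesis r4_le : forall w, r4 <= prb w origin 4.

Lemma hit_le_prb w z n : hit w z n <= prb w z n.
Proof.
elim: n w z => [//|n IH] w z /=; case: ifP => _.
  by apply: sum_stp_ge0 => d; exact: prb_ge0.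
exact: ler_sum_stp.
Qed.

(** A first hit at time n + 2, and a first hit at time n followed by a return in two steps, are
    disjoint ways to be at [z] at time n + 2. [hit4_le_prb] adds first hits four steps earlier. *)
Lemma hit2_le_prb w z n : hit w z n.+2 + r2 * hit w z n <= prb w z n.+2.
Proof.
elim: n w z => [|n IH] w z.
  rewrite [X in _ * X]/=; case: eqP => [->|_]; last by rewrite mulr0 addr0 hit_le_prb.
  by rewrite [hit _ _ _]/= mulr1 add0r.
rewrite [hit _ _ n.+3]/= [hit _ _ n.+1]/=; case: ifP => _.
  by rewrite mulr0 addr0 prb_ge0.
rewrite mulr_sumr -big_split; apply: ler_sum => d _ /=.
by rewrite mulrCA -mulrDr; exact/ler_stp/IH.
Qed.

Lemma hit4_le_prb w z n :
  hit w z n.+4 + r2 * hit w z n.+2 + r4 * hit w z n <= prb w z n.+4.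
Proof.
elim: n w z => [|n IH] w z.
  rewrite [X in _ + r4 * X]/=; case: eqP => [->|_]; last first.
    by rewrite mulr0 addr0; exact: hit2_le_prb.
  by rewrite [hit _ _ 4]/= [hit _ _ 2]/= mulr1 mulr0 !add0r.
rewrite [hit _ _ n.+4.+1]/= [hit _ _ n.+3]/= [hit _ _ n.+1]/=; case: ifP => _.
  by rewrite !mulr0 !addr0 prb_ge0.
rewrite !mulr_sumr -!big_split; apply: ler_sum => d _ /=.
rewrite [r2 * _]mulrCA [r4 * _]mulrCA -!mulrDr.
by exact/ler_stp/IH.
Qed.

(** All three hitting times exceed [s], so each forces survival up to [s]; the successor in [n.+1]
    guarantees this for the earliest one. *)
Lemma vis_ge w z s n :
  hit w z (s + n.+1).+4 + r2 * hit w z (s + n.+1).+2 + r4 * hit w z (s + n.+1)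
  <= vis w z s n.+1.+4.
Proof.
elim: s w z => [|s IH] w z.
  rewrite add0n [vis _ _ _ _]/=; case: ifP => z0; last exact: hit4_le_prb.
  by rewrite [hit _ _ n.+1.+4]/= [hit _ _ n.+3]/= [hit _ _ n.+1]/= z0 !mulr0 !addr0.
rewrite addSn [hit _ _ _]/= [hit _ _ (s + n.+1).+3]/= [hit _ _ (s + n.+1).+1]/= [vis _ _ _ _]/=.
case: ifP => z0; first by rewrite !mulr0 !addr0.
rewrite !mulr_sumr -!big_split; apply: ler_sum => d _ /=.
rewrite [r2 * _]mulrCA [r4 * _]mulrCA -!mulrDr.
by exact/ler_stp/IH.
Qed.

End Visits.
End Walk.

(** * Return probabilities *)

Definition dirs : seq pt := [:: (1, 0); (-1, 0); (0, 1); (0, -1)].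

Definition add3 (a b : nat * nat * nat) : nat * nat * nat :=
  (a.1.1 + b.1.1, a.1.2 + b.1.2, a.2 + b.2)%N.

(* The coefficients of degree 0, 1, 2 in q of [prb w z n], written as a
   homogeneous polynomial of degree n in q = 1 - p and p / 4. *)
Fixpoint coefs (l : seq pt) (z : pt) : nat * nat * nat :=
  if l is v :: l' then
    let a := foldr (fun d => add3 (coefs l' (psub z d))) (0, 0, 0)%N dirs in
    let b := coefs l' (psub z v) in
    (a.1.1, a.1.2 + b.1.1, a.2 + b.1.2)%N
  else (nat_of_bool (z == origin), 0, 0)%N.

Fixpoint steps (w : nat -> 'I_4) n : seq pt :=
  if n is m.+1 then dir (w 0%N) :: steps (later w) m else [::].

Lemma dir_dirs e : dir e \in dirs.
Proof. by case: e => [[|[|[|[|]]]] ?]. Qed.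

Lemma coefs2 w : (coefs (steps w 2) origin).1 = (4, 2)%N.
Proof.
have: all (fun a => all (fun b =>
   (coefs [:: a; b] origin).1 == (4, 2)%N) dirs) dirs by vm_compute.
by move=> /allP /(_ _ (dir_dirs (w 0%N))) /allP /(_ _ (dir_dirs (w 1%N))) /eqP.
Qed.

(** All 256 instruction words are checked by computation. Only the coefficient of degree 2 depends
    on the word; its least value 6 is attained by constant words. *)
Lemma coefs4 w : let c := coefs (steps w 4) origin in
  c.1 = (36, 36)%N /\ (6 <= c.2)%N.
Proof.
have: all (fun a => all (fun b => all (fun c => all (fun d =>
   let x := coefs [:: a; b; c; d] origin in
   (x.1 == (36, 36)%N) && (6 <= x.2)%N) dirs) dirs) dirs) dirs by vm_compute.
move=> /allP /(_ _ (dir_dirs (w 0%N))) /allP /(_ _ (dir_dirs (w 1%N))).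
by move=> /allP /(_ _ (dir_dirs (w 2%N))) /allP /(_ _ (dir_dirs (w 3%N))) /andP[/eqP].
Qed.

Section Returns.
Context {R : realType} (p : R).
Hypotheses (p_gt0 : 0 < p) (p_le1 : p <= 1).

(** The ratio of the two variables of the homogeneous polynomial: factoring out [(p / 4) ^+ n]
    leaves a polynomial in [rho]. *)
Let rho : R := (1 - p) / (p / 4).

Definition eval3 (r : R) (c : nat * nat * nat) : R :=
  c.1.1%:R + c.1.2%:R * r + c.2%:R * r ^+ 2.

Lemma eval3D r a b : eval3 r (add3 a b) = eval3 r a + eval3 r b.
Proof. by rewrite /eval3 /= !natrD; ring. Qed.

Lemma coefs_le_prb n w z :
  (p / 4) ^+ n * eval3 rho (coefs (steps w n) z) <= prb p w z n.
Proof.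
have rho_ge0 : 0 <= rho by apply: divr_ge0; have := p_gt0; have := p_le1; lra.
have rhoE : 1 - p = p / 4 * rho by rewrite /rho; field; rewrite gt_eqF.
have p4 : 0 <= p / 4 by have := p_gt0; lra.
elim: n w z => [|n IH] w z; first by rewrite /eval3 /= !mul0r !addr0 mul1r.
rewrite [prb _ _ _ _]/= sum_stpE.
set l := steps (later w) n; set b := coefs l (after z (w 0%N)).
set a := foldr (fun d => add3 (coefs l (psub z d))) (0, 0, 0)%N dirs.
have -> : coefs (steps w n.+1) z = (a.1.1, a.1.2 + b.1.1, a.2 + b.1.2)%N by [].
have -> : \sum_d prb p (later w) (after z d) n
   = \sum_(v <- dirs) prb p (later w) (psub z v) n.
  by rewrite !big_ord_recl big_ord0 !big_cons big_nil.
apply: (@le_trans _ _ ((p / 4) ^+ n.+1 * (eval3 rho a + rho * eval3 rho b))).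
  rewrite ler_wpM2l ?exprn_ge0 // /eval3 /= !natrD -subr_ge0.
  (* Multiplication by [rho] moves the top coefficient to degree 3, where the truncation drops it;
     the term is nonnegative. *)
  rewrite [X in 0 <= X](_ : _ = b.2%:R * rho ^+ 3); last by ring.
  by rewrite mulr_ge0 ?exprn_ge0.
rewrite mulrDr [leRHS]addrC; apply: lerD; last first.
  rewrite rhoE [leLHS](_ : _ = p / 4 * rho * ((p / 4) ^+ n * eval3 rho b)).
    by apply: ler_wpM2l; [exact: mulr_ge0 | exact: IH].
  by rewrite exprS; ring.
rewrite exprS -mulrA; apply: ler_wpM2l => //; rewrite /a.
elim: dirs => [|v s IHs]; first by rewrite big_nil /eval3 /= !mul0r !addr0 mulr0.
by rewrite big_cons /= eval3D mulrDr lerD //; exact: IH.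
Qed.

Lemma return2 w : 4^-1 * p ^+ 2 + 2^-1 * p * (1 - p) <= prb p w origin 2.
Proof.
apply: le_trans (coefs_le_prb 2 w origin).
have := coefs2 w; case: (coefs _ _) => [[a b] c] /= [-> ->].
rewrite [leRHS](_ : _ = 4^-1 * p ^+ 2 + 2^-1 * p * (1 - p) + c%:R * (1 - p) ^+ 2).
  by rewrite lerDl mulr_ge0 ?sqr_ge0.
by rewrite /eval3 /rho /=; field; rewrite gt_eqF.
Qed.

Lemma return4 w :
  9 / 64 * p ^+ 4 + 9 / 16 * p ^+ 3 * (1 - p) + 3 / 8 * p ^+ 2 * (1 - p) ^+ 2
  <= prb p w origin 4.
Proof.
apply: le_trans (coefs_le_prb 4 w origin).
have := coefs4 w; case: (coefs _ _) => [[a b] c] /= [[-> ->]] c6.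
rewrite [leRHS](_ : _ = 9 / 64 * p ^+ 4 + 9 / 16 * p ^+ 3 * (1 - p)
    + c%:R / 16 * p ^+ 2 * (1 - p) ^+ 2).
  rewrite lerD2l ler_wpM2r ?sqr_ge0 // ler_wpM2r ?sqr_ge0 //.
  have : 6%:R <= c%:R :> R by rewrite ler_nat.
  by lra.
by rewrite /eval3 /rho /=; field; rewrite gt_eqF.
Qed.

End Returns.

(** * Decay of the survival probability *)

(* Induction on k: the hypothesis at j = k / 2, where S_j <= (k / j) S_k, gives
   S_k - S_(k+1) <= 4 b (1 + o(1)) S_k / k, which is at most S_k / (k+1) once k
   is large, since 4 b < 1. *)
Lemma hazard_recursion {R : realFieldType} (S : nat -> R) (b : R) (K : nat) :
  0 <= b -> 4 * b * K%:R <= K%:R - 1 -> (1 < K)%N ->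
  (forall k, 0 <= S k) -> (forall k, (k <= K)%N -> S k = 1) ->
  (forall j k, (j < k)%N -> S k - S k.+1 <= b * S j / (k - j)%:R) ->
  forall k, k%:R * S k <= k.+1%:R * S k.+1.
Proof.
move=> b0 bK K1 S0 S1 rec; elim/ltn_ind => k IH.
have [kK|Kk] := ltnP k K; first by rewrite !S1 ?(ltnW kK) // !mulr1 ler_nat.
have mono j : (j <= k)%N -> j%:R * S j <= k%:R * S k.
  move=> /subnKC; elim: (k - j)%N {-2}j => [|m IHm] i ik; first by rewrite -ik addn0.
  by apply: (le_trans (IH i _)); [lia | apply: IHm; lia].
have b1 : 4 * b <= 1.
  rewrite -(@ler_pM2r _ K%:R) ?ltr0n; last lia.
  by apply: le_trans bK _; rewrite mul1r gerBl.
have bk : 4 * b * k%:R <= k%:R - 1.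
  rewrite -(subnKC Kk) natrD mulrDr; set x := (k - K)%:R.
  have : 4 * b * x <= x by rewrite -[leRHS]mul1r ler_wpM2r.
  by move: bK; lra.
pose j := k./2.
have jk := odd_double_half k; rewrite -/j in jk.
have j0 : (0 < j)%N by lia.
have jltk : (j < k)%N by lia.
have := rec j k jltk; have := mono j (ltnW jltk).
rewrite natrB; last lia.
have kE : k%:R = (odd k)%:R + 2 * j%:R :> R by rewrite -{1}jk natrD -muln2 natrM mulrC.
have jR : 0 < j%:R :> R by rewrite ltr0n.
have jkR : 0 < k%:R - j%:R :> R by rewrite subr_gt0 ltr_nat.
rewrite ler_pdivlMr // => h1 h2.
have h3 : b * (j%:R * S j) <= b * (k%:R * S k) by apply: ler_wpM2l.
have h4 : (S k - S k.+1) * (k%:R - j%:R) * j%:R <= b * (k%:R * S k).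
  by apply: le_trans h3; rewrite [leRHS]mulrCA mulrC ler_wpM2l // ltW.
(* Here (k - j) j is at least (k^2 - 1) / 4 in both parities, while b k is at most (k - 1) / 4. This
   explains the form of the condition on [K]. *)
have h5 : (k.+1%:R) * (b * k%:R) <= (k%:R - j%:R) * j%:R.
  rewrite -natr1; case: (odd k) kE => /= kE.
    rewrite kE in bk *; move: bk; set y := j%:R => bk.
    have y0 : 0 <= y by exact: ltW.
    have : 0 <= (y * 2 - 4 * b * (1 + 2 * y)) * (1 + y) by apply: mulr_ge0; lra.
    by rewrite /=; lra.
  rewrite kE in bk *; move: bk; set y := j%:R => bk.
  have y0 : 0 <= y by exact: ltW.
  have : 0 <= (y * 2 - 1 - 4 * b * (2 * y)) * (1 + 2 * y) by apply: mulr_ge0; lra.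
  by rewrite /=; lra.
have D0 : 0 < (k%:R - j%:R) * j%:R :> R by exact: mulr_gt0.
have : ((k%:R - j%:R) * j%:R) * (k.+1%:R * (S k - S k.+1)) <=
       ((k%:R - j%:R) * j%:R) * S k.
  apply: le_trans (_ : k.+1%:R * (b * k%:R) * S k <= _); last exact: ler_wpM2r.
  by have := ler_wpM2l (ler0n R k.+1) h4; lra.
by rewrite ler_pM2l // -natr1; lra.
Qed.

Lemma sum_shift_le {R : numDomainType} (g : nat -> R) a n m :
  (forall i, 0 <= g i) -> (a + n <= m)%N ->
  \sum_(i < n) g (a + i)%N <= \sum_(i < m) g i.
Proof.
move=> g0 /subnKC <-; rewrite -addnA !big_split_ord /=.
rewrite -[leLHS]add0r lerD ?sumr_ge0 // lerDl sumr_ge0 //.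
Qed.

Lemma sum_pairs_le {R : numDomainType} (x : nat -> R) c m :
  (forall i, x i + x i.+1 <= c) -> \sum_(i < m.*2) x i <= m%:R * c.
Proof.
move=> xc; elim: m => [|m IH]; first by rewrite big_ord0 mul0r.
by rewrite doubleS !big_ord_recr /= -addrA -natr1 mulrDl mul1r lerD.
Qed.

Section Decay.
Context {R : realType} (p : R).
Hypotheses (p_gt0 : 0 < p) (p_le1 : p <= 1).
Implicit Types (w : nat -> 'I_4) (z : pt).

Definition norm1 (z : pt) : nat := (absz z.1 + absz z.2)%N.

Lemma norm1_after z d : (norm1 z <= (norm1 (after z d)).+1)%N.
Proof.
rewrite /norm1 /after /psub /dir /=; case: z => a b /=.
by case: d => [[|[|[|[|]]]] ?] //=; lia.
Qed.

Lemma norm1_away z : exists d, norm1 (after z d) = (norm1 z).+1.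
Proof.
rewrite /norm1 /after /psub /dir; case: z => a b /=.
have [a0|a0] := lerP 0 a.
  by exists (@Ordinal 4 1 isT) => /=; lia.
by exists (@Ordinal 4 0 isT) => /=; lia.
Qed.

Lemma norm1_gt0 z : (0 < norm1 z)%N -> (z == origin) = false.
Proof. by rewrite /norm1; apply: contraTF => /eqP ->. Qed.

Lemma surv_far w z t : (t < norm1 z)%N -> surv p w z t = 1.
Proof.
elim: t w z => [|t IH] w z h /=; rewrite norm1_gt0 //; last exact: leq_ltn_trans h.
rewrite -[RHS](sum_stp p (w 0%N)); apply: eq_bigr => d _.
by rewrite IH ?mulr1 //; have := norm1_after z d; lia.
Qed.

Lemma surv_escape r w z : z != origin -> exists w' z',
  (r <= norm1 z')%N /\
  forall t, (p / 4) ^+ r * surv p w' z' t <= surv p w z (r + t).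
Proof.
move=> z0.
have {z0} zn : (0 < norm1 z)%N.
  rewrite lt0n; apply: contraNneq z0; rewrite /norm1; case: z => a b /= ab.
  by apply/eqP; congr (_, _); lia.
suff: exists w' z', (r + norm1 z <= norm1 z')%N /\
    forall t, (p / 4) ^+ r * surv p w' z' t <= surv p w z (r + t).
  by move=> [w' [z' [h1 h2]]]; exists w', z'; split=> //; lia.
elim: r w z zn => [|r IH] w z zn.
  by exists w, z; split => // t; rewrite mul1r.
have [d dP] := norm1_away z.
have [|w' [z' [rz h]]] := IH (later w) (after z d); first by rewrite dP.
exists w', z'; split; first by lia.
move=> t; rewrite addSn /= norm1_gt0 // (bigD1 d) //= exprS -mulrA.
rewrite -[leLHS]addr0 lerD //; last first.
  by apply: sumr_ge0 => i _; rewrite mulr_ge0 ?stp_ge0 ?surv_ge0.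
apply: ler_pM => //; first by have := p_gt0; lra.
  by rewrite mulr_ge0 ?exprn_ge0 ?surv_ge0 //; have := p_gt0; lra.
by rewrite /stp lerDr; case: ifP => _ //; rewrite subr_ge0.
Qed.

Section Blocks.
Context (c r2 r4 : R) (n0 : nat).
Hypothesis r2_le : forall w, r2 <= prb p w origin 2.
Hypothesis r4_le : forall w, r4 <= prb p w origin 4.
Hypotheses (r2_ge0 : 0 <= r2) (r4_ge0 : 0 <= r4).
Hypothesis prb_le : forall n w z, (n0 < n)%N -> prb p w z n <= c / n%:R.
Hypotheses (c_ge0 : 0 <= c).

(** Sum [vis_ge] over the block of 2 M times after [m]. First hits in the block are counted with
    total weight 1 + r2 + r4 by visits at 2 M + 4 times, which form M + 2 consecutive pairs for
    [vis_pair]. *)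
Lemma block_hazard w z s m M : (3 < m - s)%N -> (n0 < m - s)%N -> 
  (1 + r2 + r4) * (surv p w z m - surv p w z (m + M.*2))
  <= M.+2%:R * (surv p w z s * (c / (m - s)%:R)).
Proof.
move=> ms ns.
pose x i := vis p w z s (m - s + i.+1).
have xP i : x i + x i.+1 <= surv p w z s * (c / (m - s)%:R).
  have cle n w' z' : (m - s <= n)%N -> prb p w' z' n <= c / (m - s)%:R.
    move=> msn; apply: le_trans (prb_le w' z' (leq_trans ns msn)) _.
    by rewrite ler_wpM2l // lef_pV2 ?posrE ?ltr0n ?ler_nat //; lia.
  rewrite /x [(_ + i.+2)%N]addnS; apply: vis_pair => // w' z'; apply: cle; lia.
apply: le_trans (sum_pairs_le M.+2 xP).
(* With this offset, [g i.+4], [g i.+2] and [g i] are the first hits 0, 2 and 4 steps before time m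
   + i + 1, and m - 3 still exceeds [s]. *)
pose g i := hit p w z (m - 3 + i)%N.
have g0 i : 0 <= g i by exact: hit_ge0.
apply: le_trans (_ : \sum_(i < M.+2.*2) (g i.+4 + r2 * g i.+2 + r4 * g i) <= _); last first.
  apply: ler_sum => i _; rewrite /x /g.
  have := @vis_ge R p p_gt0 p_le1 r2 r4 r2_le r4_le w z s (m - s - 4 + i).
  have -> : (m - s - 4 + i).+1.+4 = (m - s + i.+1)%N by lia.
  have -> : (s + (m - s - 4 + i).+1)%N = (m - 3 + i)%N by lia.
  by rewrite !addnS.
rewrite -sum_hit_ivl !big_split /= -!mulr_sumr !mulrDl mul1r.
have gE i : hit p w z (m + i.+1) = g i.+4.
  by rewrite /g; congr hit; lia.
have -> : \sum_(i < M.*2) hit p w z (m + i.+1) = \sum_(i < M.*2) g i.+4.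
  by apply: eq_bigr => i _; rewrite gE.
apply: lerD; [apply: lerD|]; [|apply: ler_wpM2l => //..].
- by apply: (@sum_shift_le _ (fun i => g i.+4) 0) => //; lia.
- by apply: (@sum_shift_le _ (fun i => g i.+2) 2) => //; lia.
- by apply: (@sum_shift_le _ g 4) => //; lia.
Qed.

(* c / (2 (1 + r2 + r4)) bounds the hazard coefficient b of [hazard_recursion],
   up to the factor 1 + 2 / M lost by cutting time into blocks of length 2 M. *)
Lemma surv_slow_decay : c < (1 + r2 + r4) / 2 ->
  exists L r, (0 < L)%N /\ forall w z, (r <= norm1 z)%N ->
    forall k, (0 < k)%N -> 1 <= k%:R * surv p w z (k * L).
Proof.
move=> cR; set Q := 1 + r2 + r4 in cR *.
have Q0 : 0 < Q by rewrite /Q; have := r2_ge0; have := r4_ge0; lra.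
pose e := Q / 2 - c; have e0 : 0 < e by rewrite /e; lra.
(* The condition 2 c < e M is exactly 4 b < 1 for the [b] defined below; the other two make
   [block_hazard] applicable to times at least 2 M apart. *)
have [M [M4 Mn MP]] : exists M : nat, [/\ (4 <= M)%N, (n0 <= M)%N & 2 * c < e * M%:R].
  have [M1 M1P] : exists M1 : nat, 2 * c < e * M1%:R.
    exists (Num.trunc (2 * c / e)).+1.
    by rewrite [ltRHS]mulrC -ltr_pdivrMr // truncnS_gt.
  exists (M1 + (n0 + 4))%N; split.
  - by rewrite addnA leq_addl.
  - by rewrite addnCA leq_addr.
  by apply: lt_le_trans M1P _; rewrite ler_wpM2l ?ler_nat ?(ltW e0) ?leq_addr.
have M0 : 0 < M%:R :> R by rewrite ltr0n; apply: leq_trans M4.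
pose b := c * M.+2%:R / (2 * M%:R * Q).
have b0 : 0 <= b by rewrite /b divr_ge0 ?mulr_ge0 // ?ltW.
have b1 : 4 * b < 1.
  rewrite /b mulrA ltr_pdivrMr ?mulr_gt0 // -addn2 natrD.
  by move: MP; rewrite /e; lra.
have [K KP] : exists K : nat, 1 / (1 - 4 * b) < K%:R.
  by exists (Num.trunc (1 / (1 - 4 * b))).+1; rewrite truncnS_gt.
have b1' : 0 < 1 - 4 * b by lra.
have KP' : 1 < K%:R * (1 - 4 * b) by rewrite -ltr_pdivrMr.
(* Time is counted in blocks of length 2 M. From this distance home is out of reach during the first
   K + 1 blocks, which starts the recursion. *)
exists M.*2, (K.+2 * M.*2)%N; split; first by rewrite double_gt0; apply: leq_trans M4.
move=> w z rz.
have H : forall k, k%:R * surv p w z (k * M.*2) <= k.+1%:R * surv p w z (k.+1 * M.*2).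
  apply: (@hazard_recursion _ (fun k => surv p w z (k * M.*2)) b K.+1) => //.
  - by rewrite -natr1; nra.
  - rewrite ltnS -(ltr0n R); nra.
  - by move=> k; exact: surv_ge0.
  - move=> k kK; apply: surv_far; apply: leq_trans rz.
    by rewrite ltn_mul2r double_gt0 ltnS kK andbT; apply: leq_trans M4.
  move=> j k jk.
  have kj : (M.*2 <= (k - j) * M.*2)%N by rewrite leq_pmull // subn_gt0.
  have l1 : (3 < k * M.*2 - j * M.*2)%N.
    by rewrite -mulnBl; apply: leq_trans kj; clear -M4 Mn; lia.
  have l2 : (n0 < k * M.*2 - j * M.*2)%N.
    by rewrite -mulnBl; apply: leq_trans kj; clear -M4 Mn; lia.
  have := @block_hazard w z _ _ M l1 l2; rewrite -mulnBl -/Q [(k.+1 * _)%N]mulSn [(M.*2 + _)%N]addnC => h.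
  rewrite -(ler_pM2l Q0); apply: le_trans h _.
  rewrite natrM -(muln2 M) natrM.
  have kj0 : 0 < (k - j)%:R :> R by rewrite ltr0n subn_gt0.
  rewrite le_eqVlt; apply/orP; left; apply/eqP; rewrite /b; field.
  by rewrite !gt_eqF.
elim=> [//|[|k] IH] _; last exact: le_trans (IH _) (H _).
rewrite mul1r surv_far //; apply: leq_trans rz; rewrite mul1n.
by rewrite ltn_Pmull // double_gt0; apply: leq_trans M4.
Qed.

End Blocks.

(** Escaping first costs the constant factor [d]; [surv_slow_decay] then applies. The bound is
    obtained along multiples of a block length, and arbitrarily late times are all that an infinite
    mean requires. *)
Lemma survival_lower_bound c n0 :
  c < (Rpoly p) / 2 -> 
  (forall n w z, (n0 < n)%N -> prb p w z n <= c / n%:R) ->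
  forall w z, z != origin ->
  exists2 d, 0 < d & forall N, exists2 t, (N <= t)%N & d <= t%:R * surv p w z t.
Proof.
move=> cR cP.
have c0 : 0 <= c.
  have := cP n0.+1 (fun=> ord0) origin (ltnSn _) => /(le_trans (prb_ge0 p_gt0 p_le1 _ _ _)).
  by rewrite pmulr_lge0 // invr_gt0 ltr0n.
have q0 : 0 <= 1 - p by rewrite subr_ge0.
have pp := ltW p_gt0.
have r2_ge0 : 0 <= 4^-1 * p ^+ 2 + 2^-1 * p * (1 - p) by rewrite addr_ge0 ?mulr_ge0 ?exprn_ge0.
have r4_ge0 : 0 <= 9 / 64 * p ^+ 4 + 9 / 16 * p ^+ 3 * (1 - p)
    + 3 / 8 * p ^+ 2 * (1 - p) ^+ 2 by rewrite !addr_ge0 ?mulr_ge0 ?exprn_ge0.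
have cR' : c < (1 + (4^-1 * p ^+ 2 + 2^-1 * p * (1 - p)) + (9 / 64 * p ^+ 4 +
    9 / 16 * p ^+ 3 * (1 - p) + 3 / 8 * p ^+ 2 * (1 - p) ^+ 2)) / 2.
  by move: cR; rewrite /Rpoly !addrA.
have [L [r [L0 H]]] := surv_slow_decay (return2 p_gt0 p_le1) (return4 p_gt0 p_le1)
  r2_ge0 r4_ge0 cP c0 cR'.
move=> w z z0.
have [w' [z' [rz Hz]]] := surv_escape r w z0.
have p4 : 0 < (p / 4) ^+ r by rewrite exprn_gt0 // divr_gt0.
exists ((p / 4) ^+ r) => // N; exists (r + N.+1 * L)%N.
  by apply: leq_trans (leq_addl _ _); apply: ltnW; exact: leq_pmulr.
apply: le_trans (_ : (N.+1 * L)%:R * ((p / 4) ^+ r * surv p w' z' (N.+1 * L)) <= _).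
  rewrite natrM [leRHS](_ : _ = (p / 4) ^+ r * (L%:R * (N.+1%:R * surv p w' z' (N.+1 * L)))); last by ring.
  rewrite -[leLHS]mulr1 ler_wpM2l ?(ltW p4) // -[leLHS]mulr1 ler_pM // ?ler1n //.
  exact: H.
by apply: ler_pM => //; rewrite ?mulr_ge0 ?(ltW p4) ?surv_ge0 // ler_nat leq_addl.
Qed.

End Decay.

(** * Gaussian sums and trigonometry *)

Section Gauss.
Context {R : realType}.
Local Notation mu := (@lebesgue_measure R).
Local Open Scope classical_set_scope.

(** A right-endpoint Riemann sum of a decreasing function, extended by one cell at a time. *)
Lemma gauss_sum_le_integral (h : R) n : 0 < h ->
  ((\sum_(i < n) h * gauss_fun (i.+1%:R * h))%:E <=
   \int[mu]_(x in `[0%R, (n%:R * h)%R]) (gauss_fun x)%:E)%E.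
Proof.
move=> h0; elim: n => [|n IH].
  by rewrite big_ord0 integral_ge0 // => x _; rewrite lee_fin gauss_fun_ge0.
have nh : (n%:R * h <= n.+1%:R * h)%R by rewrite ler_wpM2r ?ler_nat // ltW.
have -> : `[0%R, (n.+1%:R * h)%R] = `[0%R, (n%:R * h)%R] `|` `](n%:R * h)%R, (n.+1%:R * h)%R].
  by rewrite -itv_bndbnd_setU // bnd_simp mulr_ge0 // ltW.
rewrite ge0_integral_setU //=; last 3 first.
- by apply/measurable_EFinP/measurable_funTS; exact: measurable_gauss_fun.
- by move=> x _; rewrite lee_fin gauss_fun_ge0.
- by apply/disj_setPS => x /= []; rewrite !in_itv /= => /andP[_ h1] /andP[h2 _]; move: h1; rewrite leNgt h2.
rewrite big_ord_recr /= EFinD leeD //.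
apply: (@le_trans _ _ (\int[mu]_(x in `](n%:R * h)%R, (n.+1%:R * h)%R]) (cst (gauss_fun (n.+1%:R * h))%:E x))%E).
  rewrite integral_cst //= lebesgue_measure_itv /= lte_fin ltr_pM2r // ltr_nat ltnSn.
  by rewrite -EFinB -EFinM lee_fin -natr1 -mulrBl addrAC subrr add0r mul1r mulrC.
apply: ge0_le_integral => //=.
- by move=> x _; rewrite lee_fin gauss_fun_ge0.
- by apply/measurable_EFinP/measurable_funTS; exact: measurable_gauss_fun.
move=> x; rewrite in_itv /= => /andP[x1 x2].
rewrite lee_fin /gauss_fun ler_expR lerN2 lerXn2r ?nnegrE //.
  by apply: le_trans (ltW x1); rewrite mulr_ge0 // ltW.
by rewrite mulr_ge0 // ltW.
Qed.

Lemma gauss_sum_le (h : R) n : 0 < h ->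
  \sum_(i < n) gauss_fun (i.+1%:R * h) <= Num.sqrt pi / (2 * h).
Proof.
move=> h0; rewrite invfM mulrA ler_pdivlMr // mulr_suml.
under eq_bigr do rewrite mulrC.
rewrite -lee_fin; apply: le_trans (gauss_sum_le_integral n h0) _.
rewrite -integral0y_gauss; apply: ge0_subset_integral => //=.
- by apply/measurable_EFinP/measurable_funTS; exact: measurable_gauss_fun.
- by move=> x _; rewrite lee_fin gauss_fun_ge0.
by apply: subset_itvl; rewrite bnd_simp.
Qed.

End Gauss.

Section Trig.
Context {R : realType}.
Implicit Types (x y t K eta : R).

Lemma sin_ge_mul_cos t : 0 <= t <= pi / 2 -> t * cos t <= sin t.
Proof.
move=> /andP[t0 t1].
have pp : pi / 2 <= pi :> R by have := @pi_gt0 R; lra.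
have [c] : exists2 c, c \in `[0, t] & sin t - sin 0 = cos c * (t - 0).
  apply: MVT_segment => //; apply: continuous_subspaceT; exact: continuous_sin.
rewrite in_itv /= sin0 !subr0 => /andP[c0 ct] ->.
rewrite mulrC ler_wpM2r //; move: ct; rewrite le_eqVlt => /predU1P[->//|ct].
apply/ltW; rewrite ltr_cos // in_itv /=; apply/andP; split => //; lra.
Qed.

Lemma one_sub_cos x : 1 - cos x = 2 * sin (x / 2) ^+ 2.
Proof.
have {1}-> : x = (x / 2) *+ 2 by rewrite -mulr_natr; field.
by rewrite cos_mulr2n cos2sin2 -mulr_natr; ring.
Qed.

(** Let s = sin (x / 2). If s^2 is at least eta, the first term suffices; otherwise s is at least (x
    / 2) cos (x / 2) with cos^2 above 1 - eta, which gives the Gaussian term. *)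
Lemma expR_one_sub_cos_le x K eta : 0 <= x <= pi -> 0 <= K -> 0 <= eta ->
  expR (- (K * (1 - cos x))) <=
  expR (- (2 * K * eta)) + expR (- (K * (1 - eta) * x ^+ 2 / 2)).
Proof.
move=> /andP[x0 xpi] K0 eta0; rewrite one_sub_cos.
have x2 : 0 <= x / 2 <= pi / 2 by apply/andP; split; lra.
have st := sin_ge_mul_cos x2.
have ct : 0 <= cos (x / 2) by apply: cos_ge0_pihalf; apply/andP; split; lra.
have := cos2sin2 (x / 2); set s := sin _ in st *; set c := cos _ in st ct * => cs.
have [sg|sg] := lerP eta (s ^+ 2).
  rewrite -[leLHS]addr0 lerD ?expR_ge0 // ler_expR lerN2.
  by rewrite -mulrA mulrCA ler_wpM2l // ler_wpM2l.
rewrite -[leLHS]add0r lerD ?expR_ge0 // ler_expR lerN2.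
rewrite -!mulrA ler_wpM2l //.
apply: (@le_trans _ _ (2 * (x / 2 * c) ^+ 2)).
  rewrite exprMn cs; have : 0 <= (eta - s ^+ 2) * x ^+ 2 by rewrite mulr_ge0 ?sqr_ge0 // subr_ge0 ltW.
  by lra.
have u0 : 0 <= x / 2 * c by rewrite mulr_ge0 //; lra.
by rewrite ler_wpM2l // lerXn2r // nnegrE //; exact: le_trans st.
Qed.

Lemma cos_2pi_int (m : int) : cos (m%:~R * (pi *+ 2)) = 1 :> R /\ sin (m%:~R * (pi *+ 2)) = 0 :> R.
Proof.
have H (n : nat) : cos (n%:R * (pi *+ 2)) = 1 :> R /\ sin (n%:R * (pi *+ 2)) = 0 :> R.
  rewrite -[n%:R * _]add0r mulr_natl.
  by rewrite (periodicn (@cosD2pi R)) (periodicn (@sinD2pi R)) cos0 sin0.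
case: m => n; first exact: H.
by rewrite NegzE mulrNz mulNr cosN sinN; have [-> ->] := H n.+1; rewrite oppr0.
Qed.

(* Rotating by y permutes the N-th roots of unity cyclically, so the vector
   (sum of cosines, sum of sines) is fixed by a rotation. *)
Lemma sum_cos_sin_ge0 y N : cos (N%:R * y) = 1 -> sin (N%:R * y) = 0 ->
  0 <= \sum_(j < N) cos (j%:R * y) /\ \sum_(j < N) sin (j%:R * y) = 0.
Proof.
move=> cN sN; set C := \sum_(j < N) _; set S := \sum_(j < N) _.
have rot (f : R -> R) : f (N%:R * y) = f 0 ->
    \sum_(j < N) f (j%:R * y + y) = \sum_(j < N) f (j%:R * y).
  move=> fN; apply: (addrI (f 0)).
  transitivity (\sum_(j < N.+1) f (j%:R * y)).
    rewrite big_ord_recl mul0r; congr (_ + _); apply: eq_bigr => j _.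
    by rewrite /bump /= natrD mulrDl mul1r addrC.
  rewrite big_ord_recr /= fN; exact: addrC.
have e1 : C * cos y - S * sin y = C.
  rewrite -[RHS](rot (@cos R)) ?cN ?cos0 // /C /S !mulr_suml -sumrB.
  by apply: eq_bigr => j _; rewrite cosD.
have e2 : S * cos y + C * sin y = S.
  rewrite -[RHS](rot (@sin R)) ?sN ?sin0 // /C /S !mulr_suml -big_split.
  by apply: eq_bigr => j _; rewrite sinD.
have [cy|cy] := eqVneq (cos y) 1.
  have sy : sin y = 0 by apply: cos1sin0; rewrite cy normr1.
  have H j : cos (j%:R * y) = 1 /\ sin (j%:R * y) = 0.
    elim: j => [|j [IHc IHs]]; first by rewrite mul0r cos0 sin0.
    by rewrite -natr1 mulrDl mul1r cosD sinD IHc IHs cy sy; split; ring.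
  split; first by apply: sumr_ge0 => j _; have [-> _] := H j.
  by apply: big1 => j _; have [_ ->] := H j.
have D0 : (1 - cos y) ^+ 2 + sin y ^+ 2 != 0.
  by rewrite gt_eqF // ltr_wpDr ?sqr_ge0 // lt_neqAle sqr_ge0 eq_sym sqrf_eq0 subr_eq0 eq_sym cy.
have e1' : C * (1 - cos y) = - (S * sin y) by rewrite mulrBr mulr1 -{1}e1; ring.
have e2' : S * (1 - cos y) = C * sin y by rewrite mulrBr mulr1 -{1}e2; ring.
have C0 : C = 0.
  apply: (mulIf D0); rewrite mul0r mulrDr !expr2 !mulrA e1' -e2'; ring.
have S0 : S = 0.
  apply: (mulIf D0); rewrite mul0r mulrDr !expr2 !mulrA e2' -[S * sin y]opprK -e1'; ring.
by rewrite C0 S0.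
Qed.

End Trig.

(** * Fourier inversion on a finite torus *)

Section Grid.
Context {R : realType}.
Implicit Types (K eta : R) (n : nat).

(** A Riemann sum for 2 n exp (-K) I_0(K), with I_0 the modified Bessel function. The even number of
    angles makes rotation by pi a symmetry of the grid. *)
Definition gridsum K n : R := \sum_(j < n.*2) expR (- (K * (1 - cos (j%:R * (pi / n%:R))))).

Lemma gridsum_antipodal K n : (0 < n)%N ->
  \sum_(j < n.*2) expR (- (K * (1 + cos (j%:R * (pi / n%:R))))) = gridsum K n.
Proof.
move=> n0; have nR : n%:R != 0 :> R by rewrite pnatr_eq0 -lt0n.
have half (j : nat) : cos ((n + j)%:R * (pi / n%:R)) = - cos (j%:R * (pi / n%:R)) :> R.
  by rewrite -cosDpi; congr cos; rewrite natrD; field.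
rewrite /gridsum -addnn !big_split_ord /= addrC; congr (_ + _);
  by apply: eq_bigr => j _; rewrite half ?opprK.
Qed.

(** Reflection folds the angles onto [0, pi]. Angle 0 yields the term 1 / n, and
    [expR_one_sub_cos_le] splits the others into a constant and a Gaussian sum. *)
Lemma gridsum_le K eta n : (0 < n)%N -> 0 < K -> 0 <= eta < 1 ->
  gridsum K n <=
  2 * n%:R * (n%:R^-1 + expR (- (2 * K * eta)) + (Num.sqrt (2 * pi * (K * (1 - eta))))^-1).
Proof.
move=> n0 K0 /andP[eta0 eta1]; have nR : 0 < n%:R :> R by rewrite ltr0n.
have pi0 := @pi_gt0 R.
pose g (j : nat) : R := expR (- (K * (1 - cos (j%:R * (pi / n%:R))))).
have refl (i : nat) : (i < n)%N -> g (n + (n - i.+1))%N = g i.+1.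
  move=> ni; rewrite /g; congr (expR (- (K * (1 - _)))).
  rewrite -cosN -[LHS](cosD2pi (- _)); congr cos.
  rewrite addnBA // natrB; last by rewrite (leq_trans ni) // leq_addr.
  by rewrite natrD -mulr_natr; field; rewrite gt_eqF.
have half : gridsum K n <= 2 * (1 + \sum_(i < n) g i.+1).
  rewrite /gridsum -addnn big_split_ord /= mulr_natl mulr2n lerD //.
    have -> : 1 + \sum_(i < n) g i.+1 = \sum_(i < n.+1) g i.
      by rewrite big_ord_recl /g mul0r cos0 subrr mulr0 oppr0 expR0.
    by rewrite big_ord_recr /= lerDl expR_ge0.
  rewrite (reindex_inj rev_ord_inj) /= -[leLHS]add0r lerD //.
  by apply: ler_sum => i _; rewrite -refl.
apply: le_trans half _.
have a0 : 0 < K * (1 - eta) by rewrite mulr_gt0 // subr_gt0.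
set a := K * (1 - eta) in a0 *.
pose h := Num.sqrt (a / 2) * (pi / n%:R).
have h0 : 0 < h by rewrite mulr_gt0 ?sqrtr_gt0 ?divr_gt0.
have gle (i : 'I_n) : g i.+1 <= expR (- (2 * K * eta)) + gauss_fun (i.+1%:R * h).
  apply: le_trans (@expR_one_sub_cos_le _ _ K eta _ (ltW K0) eta0) _.
    apply/andP; split; first by rewrite mulr_ge0 // divr_ge0 // ltW.
    by rewrite mulrCA -[leRHS]mulr1 ler_pM2l // ler_pdivrMr // mul1r ler_nat.
  rewrite lerD2l /gauss_fun ler_expR lerN2 /h !exprMn sqr_sqrtr; last first.
    by rewrite divr_ge0 // ltW.
  by rewrite /a le_eqVlt; apply/orP; left; apply/eqP; field; rewrite gt_eqF.
have : \sum_(i < n) g i.+1 <= n%:R * expR (- (2 * K * eta)) + Num.sqrt pi / (2 * h).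
  apply: le_trans (ler_sum _ (fun i _ => gle i)) _.
  by rewrite big_split /= sumr_const card_ord -[_ *+ _]mulr_natl lerD2l gauss_sum_le.
suff -> : Num.sqrt pi / (2 * h) = n%:R * (Num.sqrt (2 * pi * a))^-1.
  move=> hs; rewrite -mulrA ler_wpM2l // -addrA mulrDr divff ?gt_eqF // lerD2l.
  by rewrite mulrDr.
have -> : 2 * pi * a = 2 ^+ 2 * (pi * (a / 2)) by field.
have pa : 0 <= pi * (a / 2) by rewrite mulr_ge0 ?divr_ge0 ?ltW.
rewrite sqrtrM ?sqr_ge0 // sqrtr_sqr ger0_norm // sqrtrM ?ltW //.
have s1 : Num.sqrt pi != 0 :> R by rewrite gt_eqF ?sqrtr_gt0.
have s2 : Num.sqrt (a / 2) != 0 :> R by rewrite gt_eqF ?sqrtr_gt0 ?divr_gt0.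
rewrite /h -{2}(sqr_sqrtr (ltW pi0)); field.
by rewrite s1 s2 gt_eqF.
Qed.

End Grid.

(** * Characteristic functions of the walk *)

Section Fourier.
Context {R : realType} (p : R).
Implicit Types (w : nat -> 'I_4) (z : pt) (d e : 'I_4) (n : nat) (a b u : R).

Definition phase a b z : R := z.1%:~R * a + z.2%:~R * b.

Lemma phase_after a b z d : phase a b (after z d) = phase a b z - phase a b (dir d).
Proof. by rewrite /phase /after /psub /= !rmorphB /=; ring. Qed.

(* E cos (u - phase a b X_n) *)
Fixpoint cosmean a b w n u : R :=
  if n is m.+1 then
    \sum_d stp p (w 0%N) d * cosmean a b (later w) m (u - phase a b (dir d))
  else cos u.

(* |E exp (i phase a b Y)|^2 for a step Y instructed by e *)
Definition charnorm a b e : R :=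
  (\sum_d stp p e d * cos (phase a b (dir d))) ^+ 2 +
  (\sum_d stp p e d * sin (phase a b (dir d))) ^+ 2.

(** A + i B is the characteristic function of X_n, the product of those of the independent steps;
    its squared modulus is therefore a product of [charnorm]. *)
Lemma cosmean_form a b w n : exists A B,
  A ^+ 2 + B ^+ 2 = \prod_(i < n) charnorm a b (w i) /\
  forall u, cosmean a b w n u = A * cos u + B * sin u.
Proof.
elim: n w => [|n IH] w.
  by exists 1, 0; split=> [|u]; rewrite ?big_ord0 /=; ring.
have [A [B [AB cE]]] := IH (later w).
pose C := \sum_d stp p (w 0%N) d * cos (phase a b (dir d)).
pose S := \sum_d stp p (w 0%N) d * sin (phase a b (dir d)).
exists (A * C - B * S), (A * S + B * C); split.
  rewrite big_ord_recl (_ : \prod_(i < n) _ = A ^+ 2 + B ^+ 2); last by rewrite AB.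
  by rewrite /charnorm -/C -/S; ring.
move=> u /=; rewrite /C /S !(mulr_sumr, mulr_suml) -sumrB -big_split /= !mulr_suml -big_split /=.
by apply: eq_bigr => d _; rewrite cE cosB sinB; ring.
Qed.

Lemma cosmean_le a b w n u (y : 'I_n -> R) :
  (forall i : 'I_n, charnorm a b (w i) <= expR (- (2 * y i))) ->
  cosmean a b w n u <= expR (- \sum_i y i).
Proof.
move=> yP; have [A [B [AB ->]]] := cosmean_form a b w n.
have cn0 e : 0 <= charnorm a b e by rewrite addr_ge0 ?sqr_ge0.
have le : A ^+ 2 + B ^+ 2 <= expR (- \sum_i y i) ^+ 2.
  rewrite AB -expRM_natl mulrN mulr_sumr -sumrN expR_sum.
  by apply: ler_prod => i _; apply/andP.
have [h|h] := lerP (A * cos u + B * sin u) 0.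
  exact: le_trans h (expR_ge0 _).
rewrite -(@ler_pXn2r _ 2) ?nnegrE ?expR_ge0 ?(ltW h) //; apply: le_trans le.
have -> : A ^+ 2 + B ^+ 2 = (A ^+ 2 + B ^+ 2) * (cos u ^+ 2 + sin u ^+ 2) by rewrite cos2Dsin2 mulr1.
have : 0 <= (A * sin u - B * cos u) ^+ 2 by exact: sqr_ge0.
by lra.
Qed.

Hypotheses (p_gt0 : 0 < p) (p_le1 : p <= 1).

(* Inversion on the N x N torus; the inequality absorbs the wrap-around. *)
Lemma prb_le_grid w z n (N : nat) : (0 < N)%N ->
  N%:R ^+ 2 * prb p w z n <= \sum_(j < N) \sum_(k < N)
    cosmean (j%:R * (pi *+ 2 / N%:R)) (k%:R * (pi *+ 2 / N%:R)) w n
      (phase (j%:R * (pi *+ 2 / N%:R)) (k%:R * (pi *+ 2 / N%:R)) z).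
Proof.
move=> N0; have NR : N%:R != 0 :> R by rewrite pnatr_eq0 -lt0n.
elim: n w z => [|n IH] w z; last first.
  rewrite /= mulr_sumr.
  under [leRHS]eq_bigr do rewrite exchange_big /=.
  rewrite exchange_big /=; apply: ler_sum => d _.
  rewrite mulrCA; under eq_bigr do rewrite -mulr_sumr.
  rewrite -mulr_sumr; apply: ler_stp => //; apply: le_trans (IH _ _) _.
  by under eq_bigr do under eq_bigr do rewrite phase_after.
rewrite /=; set x := pi *+ 2 / N%:R.
have xN (m : int) : cos (N%:R * (m%:~R * x)) = 1 /\ sin (N%:R * (m%:~R * x)) = 0.
  by rewrite /x mulrCA [N%:R * _]mulrC divfK //; exact: cos_2pi_int.
have [->|z0] := eqVneq z origin.
  rewrite (_ : \sum_(j < N) _ = \sum_(j < N) \sum_(k < N) 1).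
    by rewrite !sumr_const card_ord mulr1 -natrX expnS expn1 -mulrnA.
  by apply: eq_bigr => j _; apply: eq_bigr => k _; rewrite /phase /= !mul0r addr0 cos0.
rewrite mulr0.
have [c1 s1] := sum_cos_sin_ge0 (xN z.1).1 (xN z.1).2.
have [c2 s2] := sum_cos_sin_ge0 (xN z.2).1 (xN z.2).2.
rewrite (_ : \sum_(j < N) _ = 
  (\sum_(j < N) cos (j%:R * (z.1%:~R * x))) * (\sum_(k < N) cos (k%:R * (z.2%:~R * x))) -
  (\sum_(j < N) sin (j%:R * (z.1%:~R * x))) * (\sum_(k < N) sin (k%:R * (z.2%:~R * x)))).
  by rewrite s1 mul0r subr0 mulr_ge0.
rewrite !big_distrlr /= -sumrB; apply: eq_bigr => j _.
rewrite -sumrB; apply: eq_bigr => k _; rewrite /phase cosD.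
by rewrite [z.1%:~R * _]mulrCA [z.2%:~R * _]mulrCA.
Qed.

(** The squared modulus [charnorm] in terms of the cosines of the frequencies along ([c1]) and
    across ([c2]) the instructed axis. The sign of the instruction disappears in the modulus. *)
Definition quadnorm (c1 c2 : R) : R :=
  (1 - p) ^+ 2 + (1 - p) * p * c1 * (c1 + c2) + p ^+ 2 * (c1 + c2) ^+ 2 / 4.

Lemma charnormE a b e :
  charnorm a b e = if (e < 2)%N then quadnorm (cos a) (cos b) else quadnorm (cos b) (cos a).
Proof.
have [p0 p1 p2 p3] : [/\ phase a b (1, 0) = a, phase a b (-1, 0) = - a,
    phase a b (0, 1) = b & phase a b (0, -1) = - b].
  by rewrite /phase /=; split; ring.
have := congr1 ( *%R ((1 - p) ^+ 2)) (cos2Dsin2 a).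
have := congr1 ( *%R ((1 - p) ^+ 2)) (cos2Dsin2 b).
rewrite /charnorm !sum_stpE !big_ord_recl !big_ord0 /dir /= p0 p1 p2 p3 !(cosN, sinN) /quadnorm.
by case: e => [[|[|[|[|]]]] ?] //=; rewrite ?(p0, p1, p2, p3, cosN, sinN); lra.
Qed.

End Fourier.

(** * The local limit bound *)

Section LocalLimit.
Context {R : realType} (p eta : R).
Hypotheses (p_gt0 : 0 < p) (p_le1 : p <= 1) (eta_gt0 : 0 < eta) (eta_lt1 : eta < 1).
Implicit Types (w : nat -> 'I_4) (z : pt) (e : 'I_4) (n : nat) (a b u : R).

(* (1 - eta) times half the variance of a step, along and across the
   instructed direction. *)
Let A : R := (1 - eta) * (p * (3 - 2 * p)) / 2.
Let B : R := (1 - eta) * p / 2.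
Let delta : R := p ^+ 2 * eta / 4.

(** To first order in 1 - c1 and 1 - c2 this is an equality with [A] and [B] stripped of their
    factor 1 - eta; that factor absorbs the second-order terms in the given range. *)
Lemma quadnorm_near (c1 c2 : R) : c1 <= 1 -> c2 <= 1 -> 2 - (c1 + c2) <= eta ->
  quadnorm p c1 c2 <= expR (- (2 * (A * (1 - c1) + B * (1 - c2)))).
Proof.
have [pg pl eg el] : [/\ 0 < p, p <= 1, 0 < eta & eta < 1] by [].
move=> h1 h2 h; apply: le_trans (expR_ge1Dx _).
have pq : 0 <= p * (1 - p) by apply: mulr_ge0; lra.
have x1 : 0 <= p * (1 - p) * ((1 - c1) * (eta - (2 - (c1 + c2)))).
  by apply: mulr_ge0; rewrite ?sqr_ge0 //; apply: mulr_ge0; lra.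
have x2 : 0 <= p * (1 - p) * (eta * (2 - (c1 + c2))).
  by apply: mulr_ge0; rewrite ?sqr_ge0 //; apply: mulr_ge0; lra.
have x2' : 0 <= p * (1 - p) * (eta * (1 - c1)).
  by apply: mulr_ge0; rewrite ?sqr_ge0 //; apply: mulr_ge0; lra.
have x3 : 0 <= p ^+ 2 * ((2 - (c1 + c2)) * (eta - (2 - (c1 + c2)))).
  by apply: mulr_ge0; rewrite ?sqr_ge0 //; apply: mulr_ge0; lra.
have x4 : 0 <= p ^+ 2 * (eta * (2 - (c1 + c2))).
  by apply: mulr_ge0; rewrite ?sqr_ge0 //; apply: mulr_ge0; lra.
by rewrite /quadnorm /A /B; lra.
Qed.

(** Away from the frequencies (0, 0) and (pi, pi), where |c1 + c2| = 2, the p^2 term alone gives a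
    definite loss. *)
Lemma quadnorm_far (c1 c2 : R) : -1 <= c1 <= 1 -> -1 <= c2 <= 1 ->
  `|c1 + c2| <= 2 - eta -> quadnorm p c1 c2 <= expR (- (2 * delta)).
Proof.
have [pg pl eg el] : [/\ 0 < p, p <= 1, 0 < eta & eta < 1] by [].
move=> /andP[l1 u1] /andP[l2 u2]; rewrite ler_norml => /andP[l u].
apply: le_trans (expR_ge1Dx _).
have pq : 0 <= p * (1 - p) by apply: mulr_ge0; lra.
have c12 : c1 * (c1 + c2) <= 2.
  have : 0 <= (1 - c1) * (1 + c2) by apply: mulr_ge0; lra.
  have : 0 <= (1 + c1) * (1 - c2) by apply: mulr_ge0; lra.
  have : 0 <= (1 - c1) * (1 + c1) by apply: mulr_ge0; lra.
  by lra.
have x1 : 0 <= p * (1 - p) * (2 - c1 * (c1 + c2)) by rewrite mulr_ge0 // subr_ge0.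
have x2 : 0 <= p ^+ 2 * ((2 - eta - (c1 + c2)) * (2 - eta + (c1 + c2))).
  by apply: mulr_ge0; rewrite ?sqr_ge0 //; apply: mulr_ge0; lra.
have x3 : 0 <= p ^+ 2 * (eta * (2 - eta)).
  by apply: mulr_ge0; rewrite ?sqr_ge0 //; apply: mulr_ge0; lra.
by rewrite /quadnorm /delta; lra.
Qed.

(** Shifting both frequencies by pi changes nothing: the second peak, at (pi, pi), reflects the
    period 2 of the walk. *)
Lemma quadnormN (c1 c2 : R) : quadnorm p (- c1) (- c2) = quadnorm p c1 c2.
Proof. by rewrite /quadnorm; ring. Qed.

(** Rates per coordinate axis: each instruction gives [A] to its own axis and [B] to the other, so
    [K1 w n + K2 w n] does not depend on the instructions. *)
Let k1 e : R := if (e < 2)%N then A else B.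
Let k2 e : R := if (e < 2)%N then B else A.
Let K1 w n : R := \sum_(i < n) k1 (w i).
Let K2 w n : R := \sum_(i < n) k2 (w i).

Lemma charnorm_near a b e : 2 - (cos a + cos b) <= eta ->
  charnorm p a b e <= expR (- (2 * (k1 e * (1 - cos a) + k2 e * (1 - cos b)))).
Proof.
move=> h; rewrite charnormE // /k1 /k2; case: ifP => _.
  by apply: quadnorm_near => //; exact: cos_le1.
rewrite [X in expR (- (2 * X))]addrC.
by apply: quadnorm_near; rewrite ?cos_le1 // [cos b + _]addrC.
Qed.

Lemma charnorm_antipodal a b e : 2 + (cos a + cos b) <= eta ->
  charnorm p a b e <= expR (- (2 * (k1 e * (1 + cos a) + k2 e * (1 + cos b)))).
Proof.
have cN (x : R) : - cos x <= 1 by rewrite lerNl cos_geN1.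
move=> h; rewrite charnormE // /k1 /k2; case: ifP => _; rewrite -quadnormN.
  have := @quadnorm_near (- cos a) (- cos b) (cN _) (cN _); rewrite !opprK; apply; lra.
rewrite [X in expR (- (2 * X))]addrC.
have := @quadnorm_near (- cos b) (- cos a) (cN _) (cN _); rewrite !opprK; apply; lra.
Qed.

Lemma charnorm_far a b e : `|cos a + cos b| <= 2 - eta ->
  charnorm p a b e <= expR (- (2 * delta)).
Proof.
have cc (x : R) : -1 <= cos x <= 1 by rewrite cos_geN1 cos_le1.
by move=> h; rewrite charnormE //; case: ifP => _; apply: quadnorm_far; rewrite // [cos b + _]addrC.
Qed.

(** Each frequency is near (0, 0), near (pi, pi) or far from both, and one term serves each case;
    adding them gives a single bound to sum over the torus. *)
Lemma cosmean_bound w n a b u : cosmean p a b w n u <=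
  expR (- (K1 w n * (1 - cos a))) * expR (- (K2 w n * (1 - cos b))) +
  expR (- (K1 w n * (1 + cos a))) * expR (- (K2 w n * (1 + cos b))) +
  expR (- (n%:R * delta)).
Proof.
have E0 (x y : R) : 0 <= expR x * expR y by rewrite mulr_ge0 ?expR_ge0.
have [h|h] := lerP (2 - (cos a + cos b)) eta.
  have := @cosmean_le _ p a b w n u _ (fun i => charnorm_near (w i) h).
  rewrite big_split /= -!mulr_suml opprD expRD => /le_trans; apply.
  by rewrite -addrA lerDl addr_ge0 ?expR_ge0.
have [h'|h'] := lerP (2 + (cos a + cos b)) eta.
  have := @cosmean_le _ p a b w n u _ (fun i => charnorm_antipodal (w i) h').
  rewrite big_split /= -!mulr_suml opprD expRD => /le_trans; apply.
  by rewrite addrAC lerDr addr_ge0 ?expR_ge0.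
have hf : `|cos a + cos b| <= 2 - eta by rewrite ler_norml; apply/andP; split; lra.
have := @cosmean_le _ p a b w n u _ (fun i => charnorm_far (w i) hf).
rewrite sumr_const card_ord -[delta *+ n]mulr_natl => /le_trans; apply.
by rewrite lerDr addr_ge0.
Qed.

(** Inversion on the torus of side 2 n. By [gridsum_antipodal] both peaks contribute equally, hence
    the factor 2. *)
Lemma prb_le_gridsum w z n : (0 < n)%N ->
  (2 * n%:R) ^+ 2 * prb p w z n <=
  2 * (gridsum (K1 w n) n * gridsum (K2 w n) n) + (2 * n%:R) ^+ 2 * expR (- (n%:R * delta)).
Proof.
move=> n0; have nR : n%:R != 0 :> R by rewrite pnatr_eq0 -lt0n.
have d2 : n.*2%:R = 2 * n%:R :> R by rewrite -muln2 natrM mulrC.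
have n2 : (0 < n.*2)%N by rewrite double_gt0.
have := prb_le_grid p_gt0 p_le1 w z n n2; rewrite d2.
have -> : pi *+ 2 / (2 * n%:R) = pi / n%:R :> R by rewrite -mulr_natr; field.
move=> /le_trans; apply.
apply: le_trans (ler_sum _ (fun j _ => ler_sum _ (fun k _ => cosmean_bound _ _ _ _ _))) _.
rewrite [2 * (_ * _)]mulr_natl mulr2n.
rewrite -[in X in _ <= _ * _ + X + _](gridsum_antipodal (K1 w n) n0).
rewrite -[in X in _ <= _ * _ + _ * X + _](gridsum_antipodal (K2 w n) n0).
rewrite /gridsum !big_distrlr /= -big_split /=.
have -> : (2 * n%:R) ^+ 2 * expR (- (n%:R * delta)) =
    \sum_(j < n.*2) \sum_(k < n.*2) expR (- (n%:R * delta)).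
  by rewrite !sumr_const card_ord -[RHS]mulr_natl -[expR _ *+ _]mulr_natl d2; ring.
rewrite -big_split /=; apply: ler_sum => j _.
by rewrite -!big_split.
Qed.

Let A_gt0 : 0 < A.
Proof. by rewrite divr_gt0 ?mulr_gt0 ?subr_gt0 //; have := p_le1; lra. Qed.

Let B_gt0 : 0 < B.
Proof. by rewrite divr_gt0 ?mulr_gt0 ?subr_gt0. Qed.

Let AB : B <= A.
Proof.
rewrite /A /B ler_pM2r // ler_pM2l ?subr_gt0 // -[leLHS]mulr1 ler_pM2l //.
by have := p_le1; lra.
Qed.

Lemma K1_ge w n : n%:R * B <= K1 w n.
Proof.
rewrite mulr_natl -[n in leLHS]card_ord -sumr_const; apply: ler_sum => i _.
by rewrite /k1; case: ifP.
Qed.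

Lemma K2_ge w n : n%:R * B <= K2 w n.
Proof.
rewrite mulr_natl -[n in leLHS]card_ord -sumr_const; apply: ler_sum => i _.
by rewrite /k2; case: ifP.
Qed.

(** The sum of the two factors is fixed at n (A + B) and both are at least n B, so the product is
    least when all instructions follow one axis. *)
Lemma K12_ge w n : n%:R ^+ 2 * (A * B) <= K1 w n * K2 w n.
Proof.
have s : K1 w n + K2 w n = n%:R * (A + B).
  rewrite -big_split mulr_natl -[n in RHS]card_ord -sumr_const; apply: eq_bigr => i _.
  by rewrite /k1 /k2 /=; case: ifP => // _; rewrite addrC.
have : 0 <= (K1 w n - n%:R * B) * (K2 w n - n%:R * B).
  by rewrite mulr_ge0 // subr_ge0 ?K1_ge ?K2_ge.
by rewrite -[K2 w n](addKr (K1 w n)) s; lra.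
Qed.

Let expR_inv (x : R) : 0 < x -> expR (- x) <= x^-1.
Proof.
move=> x0; rewrite expRN lef_pV2 ?posrE ?expR_gt0 //.
by apply: le_trans (expR_ge1Dx _); rewrite lerDr.
Qed.

(** The main term is the product of the two Gaussian parts, bounded by [K12_ge]. One factor 1 - eta
    comes from [A] and [B], the other from [gridsum_le]; [kappa] collects the remaining products and
    the far frequencies. *)
Lemma local_limit_upper : exists kappa : R, forall n w z, (0 < n)%N ->
  n%:R * prb p w z n <=
  2 / (pi * p * Num.sqrt (3 - 2 * p) * (1 - eta) ^+ 2) + kappa / Num.sqrt n%:R.
Proof.
have pi0 := @pi_gt0 R.
have e1 : 0 < 1 - eta by rewrite subr_gt0.
have p3 : 0 < 3 - 2 * p by have := p_le1; lra.
have d0 : 0 < delta by rewrite divr_gt0 ?mulr_gt0 ?exprn_gt0.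
pose k : R := 1 + (2 * B * eta)^-1.
pose g : R := (Num.sqrt (2 * pi * (B * (1 - eta))))^-1.
have k0 : 0 < k by rewrite addr_gt0 ?invr_gt0 ?mulr_gt0.
have g0 : 0 < g by rewrite invr_gt0 sqrtr_gt0 !mulr_gt0.
exists (2 * k ^+ 2 + 4 * k * g + 4 / delta ^+ 2) => n w z n0.
have nR : 0 < n%:R :> R by rewrite ltr0n.
set r := Num.sqrt n%:R; have r0 : 0 < r by rewrite sqrtr_gt0.
have rn : n%:R = r ^+ 2 by rewrite sqr_sqrtr // ltW.
have r1 : 1 <= r by rewrite -sqrtr1 ler_sqrt ?ler1n.
have nB : 0 < n%:R * B by rewrite mulr_gt0.
have grid_le K : n%:R * B <= K ->
    gridsum K n <= 2 * n%:R * (k / n%:R + (Num.sqrt (2 * pi * (K * (1 - eta))))^-1).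
  move=> BK; have K0 : 0 < K by exact: lt_le_trans BK.
  have eta01 : 0 <= eta < 1 by rewrite ltW.
  apply: le_trans (gridsum_le n0 K0 eta01) _.
  rewrite ler_wpM2l ?mulr_ge0 // lerD2r /k [leRHS]mulrDl [1 / _]mul1r lerD2l.
  apply: le_trans (expR_inv _) _; first by rewrite !mulr_gt0.
  rewrite -invfM lef_pV2 ?posrE ?mulr_gt0 //.
  have : 0 <= eta * (K - n%:R * B) by rewrite mulr_ge0 ?(ltW eta_gt0) // subr_ge0.
  by lra.
have g_le K : n%:R * B <= K -> (Num.sqrt (2 * pi * (K * (1 - eta))))^-1 <= g / r.
  move=> BK; have K0 : 0 < K by exact: lt_le_trans BK.
  rewrite /g -invfM -sqrtrM; last by rewrite !mulr_ge0 ?ltW.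
  have pK : 0 < 2 * pi * (K * (1 - eta)) by rewrite !mulr_gt0.
  rewrite lef_pV2 ?posrE ?sqrtr_gt0 ?mulr_gt0 // ler_sqrt ?(ltW pK) //.
  have : 0 <= pi * (1 - eta) * (K - n%:R * B).
    by rewrite mulr_ge0 ?subr_ge0 // mulr_ge0 // ltW.
  by lra.
set S1 := (Num.sqrt (2 * pi * (K1 w n * (1 - eta))))^-1.
set S2 := (Num.sqrt (2 * pi * (K2 w n * (1 - eta))))^-1.
have K10 : 0 < K1 w n by exact: lt_le_trans (K1_ge w n).
have K20 : 0 < K2 w n by exact: lt_le_trans (K2_ge w n).
have S10 : 0 <= S1 by rewrite invr_ge0 sqrtr_ge0.
have S20 : 0 <= S2 by rewrite invr_ge0 sqrtr_ge0.
have S1r : S1 <= g / r by apply: g_le; exact: K1_ge.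
have S2r : S2 <= g / r by apply: g_le; exact: K2_ge.
have S12 : 2 * n%:R * (S1 * S2) <= 2 / (pi * p * Num.sqrt (3 - 2 * p) * (1 - eta) ^+ 2).
  rewrite -mulrA ler_pM2l // /S1 /S2 -invfM -sqrtrM; last by rewrite !mulr_ge0 ?ltW.
  have -> : pi * p * Num.sqrt (3 - 2 * p) * (1 - eta) ^+ 2 =
      Num.sqrt ((pi * p * (1 - eta) ^+ 2) ^+ 2 * (3 - 2 * p)).
    rewrite sqrtrM ?sqr_ge0 // sqrtr_sqr ger0_norm; first by ring.
    by rewrite !mulr_ge0 ?ltW ?exprn_gt0.
  rewrite -ler_pdivlMl // -invfM lef_pV2 ?posrE ?mulr_gt0 ?sqrtr_gt0 ?mulr_gt0 ?exprn_gt0 ?mulr_gt0 //.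
  rewrite -[X in X * _ <= _](ger0_norm (ltW nR)) -sqrtr_sqr -sqrtrM ?sqr_ge0 //.
  have X0 : 0 < 2 * pi * (K1 w n * (1 - eta)) * (2 * pi * (K2 w n * (1 - eta))).
    by rewrite !mulr_gt0.
  rewrite ler_sqrt ?(ltW X0) //.
  have := ler_wpM2l (sqr_ge0 (2 * pi * (1 - eta))) (K12_ge w n).
  by rewrite /A /B; lra.
have prbE : n%:R * prb p w z n <= 2 * n%:R * ((k / n%:R + S1) * (k / n%:R + S2))
    + n%:R * expR (- (n%:R * delta)).
  have c0 : 0 < 4 * n%:R :> R by rewrite mulr_gt0.
  rewrite -(ler_pM2l c0).
  have := prb_le_gridsum w z n0.
  have : gridsum (K1 w n) n * gridsum (K2 w n) n <=
      (2 * n%:R * (k / n%:R + S1)) * (2 * n%:R * (k / n%:R + S2)).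
    apply: ler_pM; rewrite ?sumr_ge0 // => *; rewrite ?expR_ge0 //; apply: grid_le.
      exact: K1_ge.
    exact: K2_ge.
  by move: (k / _ + S1) (k / _ + S2) (gridsum _ _ * _) => x y t; lra.
apply: le_trans prbE _.
(* Squaring exp (-x) <= 1 / x at x = n delta / 2 gives decay of order n^-2, enough after
   multiplication by n. *)
have ed : n%:R * expR (- (n%:R * delta)) <= 4 / delta ^+ 2 / r.
  have nd : 0 < n%:R * delta / 2 by rewrite divr_gt0 ?mulr_gt0.
  have -> : n%:R * delta = 2 * (n%:R * delta / 2) by field.
  rewrite -mulrN expRM_natl; apply: (@le_trans _ _ (n%:R * (n%:R * delta / 2)^-1 ^+ 2)).
    by rewrite ler_pM2l // ler_pXn2r ?nnegrE ?expR_ge0 ?invr_ge0 ?(ltW nd) // expR_inv.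
  rewrite (_ : n%:R * _ = 4 / delta ^+ 2 / n%:R); last by field; rewrite !gt_eqF.
  rewrite ler_pM2l ?divr_gt0 ?exprn_gt0 // lef_pV2 ?posrE // rn expr2.
  by rewrite ler_peMl // ltW.
have -> : 2 * n%:R * ((k / n%:R + S1) * (k / n%:R + S2)) =
    2 * n%:R * (S1 * S2) + (2 * k ^+ 2 / n%:R + 2 * k * (S1 + S2)).
  by field; rewrite gt_eqF.
rewrite -addrA; apply: lerD => //; rewrite [leRHS]mulrDl; apply: lerD => //.
rewrite [leRHS]mulrDl; apply: lerD.
  rewrite ler_pM2l ?mulr_gt0 ?exprn_gt0 // lef_pV2 ?posrE // rn expr2.
  by rewrite ler_peMl // ltW.
rewrite (_ : 4 * k * g / r = 2 * k * (g / r + g / r)); last by field; rewrite gt_eqF.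
by rewrite ler_pM2l ?mulr_gt0 // lerD.
Qed.

End LocalLimit.

(** * The threshold and sums over finite paths *)

(** Both p sqrt (3 - 2 p) and [Rpoly] grow with p on (0, 1], so the left side exceeds its value at
    the root. *)
Lemma threshold_gt {R : realType} (p1 p : R) : 0 < p1 -> p1 < p -> p <= 1 ->
  pi * p1 * Num.sqrt (3 - 2 * p1) * Rpoly p1 = 4 ->
  4 < pi * p * Num.sqrt (3 - 2 * p) * Rpoly p.
Proof.
move=> p10 p1p ple <-; have pi0 := @pi_gt0 R.
have p0 : 0 < p by exact: lt_trans p1p.
rewrite -!mulrA ltr_pM2l // !mulrA.
have d0 : 0 < p - p1 by rewrite subr_gt0.
have a1 : 0 <= p * (1 - p) by apply: mulr_ge0; lra.
have a2 : 0 <= p1 * (1 - p1) by apply: mulr_ge0; lra.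
have a3 : 0 <= p1 * (1 - p) by apply: mulr_ge0; lra.
have a3' : 0 <= p * (1 - p1) by apply: mulr_ge0; lra.
have sqrtlt : p1 * Num.sqrt (3 - 2 * p1) < p * Num.sqrt (3 - 2 * p).
  have E (x : R) : 0 < x -> x * Num.sqrt (3 - 2 * x) = Num.sqrt (x ^+ 2 * (3 - 2 * x)).
    by move=> x0; rewrite sqrtrM ?sqr_ge0 // sqrtr_sqr gtr0_norm.
  rewrite !E // ltr_sqrt; last by apply: mulr_gt0; [rewrite exprn_gt0 | lra].
  have : 0 < (p - p1) * (3 * (p + p1) - 2 * (p ^+ 2 + p * p1 + p1 ^+ 2)).
    by apply: mulr_gt0 => //; lra.
  by lra.
have Rle : Rpoly p1 <= Rpoly p.
  have b1 : 0 <= (p + p1) * (1 - p * p1).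
    by apply: mulr_ge0; lra.
  have b2 : 0 <= p * (p * (1 - p)) by apply: mulr_ge0; lra.
  have b3 : 0 <= p1 * (p1 * (1 - p1)) by apply: mulr_ge0; lra.
  (* Expanded, [Rpoly x] is 1 + x/2 + x^2/8 - 3x^3/16 - 3x^4/64; the second factor is its difference
     quotient. *)
  have : 0 <= (p - p1) * (1 / 2 + (p + p1) / 8 - 3 / 16 * (p ^+ 2 + p * p1 + p1 ^+ 2)
      - 3 / 64 * (p ^+ 3 + p ^+ 2 * p1 + p * p1 ^+ 2 + p1 ^+ 3)).
    by apply: mulr_ge0; lra.
  by rewrite /Rpoly; lra.
have R0 : 0 < Rpoly p1.
  have [pp q] : 0 <= p1 /\ 0 <= 1 - p1 by lra.
  by rewrite /Rpoly 5?ltr_wpDr // ?mulr_ge0 ?exprn_ge0.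
apply: (@lt_le_trans _ _ (p * Num.sqrt (3 - 2 * p) * Rpoly p1)).
  by rewrite ltr_pM2r.
by rewrite ler_wpM2l // mulr_ge0 ?sqrtr_ge0 // ltW.
Qed.

(** * First-step recursion against sums over finite paths *)

Section Bridge.
Context {R : realType} (p : R).

Definition ffcons t (d : 'I_4) (e : {ffun 'I_t -> 'I_4}) : {ffun 'I_t.+1 -> 'I_4} :=
  [ffun i => if unlift ord0 i is Some j then e j else d].

Lemma ffcons0 t d (e : {ffun 'I_t -> 'I_4}) : ffcons d e ord0 = d.
Proof. by rewrite ffunE unlift_none. Qed.

Lemma ffconsS t d (e : {ffun 'I_t -> 'I_4}) j : ffcons d e (lift ord0 j) = e j.
Proof. by rewrite ffunE liftK. Qed.

Lemma sum_ffcons t (F : {ffun 'I_t.+1 -> 'I_4} -> R) :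
  \sum_e F e = \sum_d \sum_e F (ffcons d e).
Proof.
rewrite pair_bigA /=.
rewrite (reindex (fun x : 'I_4 * {ffun 'I_t -> 'I_4} => ffcons x.1 x.2)) //=.
exists (fun e => (e ord0, [ffun j => e (lift ord0 j)])) => [[d e]|e] _ /=.
  by rewrite ffcons0; congr (_, _); apply/ffunP => j; rewrite !ffunE liftK.
by apply/ffunP => i; rewrite ffunE; case: unliftP => [j|] ->; rewrite ?ffunE.
Qed.

Lemma pos0 t (e : {ffun 'I_t -> 'I_4}) : pos e 0 = origin.
Proof. by rewrite /pos !big_pred0. Qed.

Lemma pos_ffcons t d (e : {ffun 'I_t -> 'I_4}) s z :
  (pos (ffcons d e) s.+1 == z) = (pos e s == after z d).
Proof.
have S (f : pt -> int) : \sum_(i < t.+1 | (i < s.+1)%N) f (dir (ffcons d e i)) =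
    f (dir d) + \sum_(i < t | (i < s)%N) f (dir (e i)).
  rewrite big_mkcond big_ord_recl ffcons0 /=; congr (_ + _).
  by rewrite [RHS]big_mkcond; apply: eq_bigr => i _; rewrite ffconsS.
rewrite /pos /after /psub (S fst) (S snd); case: z => a b; rewrite !xpair_eqE /=.
have E (u v c : int) : (u + v == c) = (v == c - u) by apply/eqP/eqP => [<-|->]; ring.
by rewrite !E.
Qed.

Lemma forall_pos_ffcons t d (e : {ffun 'I_t -> 'I_4}) z :
  [forall s : 'I_t.+1, pos (ffcons d e) s != z] =
  (z != origin) && [forall s : 'I_t, pos e s != after z d].
Proof.
apply/forallP/andP => [H|[z0 /forallP H] s].
  split; first by have := H ord0; rewrite pos0 eq_sym.
  by apply/forallP => s; have := H (lift ord0 s); rewrite /= /bump /= pos_ffcons.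
by have [j|] := unliftP ord0 s => ->; [rewrite /= /bump /= pos_ffcons | rewrite pos0 eq_sym].
Qed.

Lemma hitE t (w : nat -> 'I_4) z :
  \sum_(e : {ffun 'I_t -> 'I_4} | (pos e t == z) && [forall s : 'I_t, pos e s != z])
    \prod_(i < t) stp p (w i) (e i) = hit p w z t.
Proof.
elim: t w z => [|t IH] w z.
  rewrite /= big_mkcond (big_pred1 [ffun i => ord0]) => [|e].
    rewrite pos0 big_ord0 eq_sym; case: eqP => //= _.
    by rewrite ifT //; apply/forallP => -[].
  by apply/esym/eqP/ffunP => -[].
rewrite big_mkcond sum_ffcons /=; case: ifPn => z0.
  by apply: big1 => d _; apply: big1 => e _; rewrite forall_pos_ffcons z0 andbF.
apply: eq_bigr => d _; rewrite -IH big_distrr /= [RHS]big_mkcond /=.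
apply: eq_bigr => e _; rewrite pos_ffcons forall_pos_ffcons z0 /=.
case: ifP => // _; rewrite big_ord_recl ffcons0; congr (_ * _).
by apply: eq_bigr => i _; rewrite ffconsS.
Qed.

Lemma dir_inj : injective dir.
Proof.
by move=> [[|[|[|[|]]]] ?] // [[|[|[|[|]]]] ?] //= _; apply: val_inj.
Qed.

Lemma hit_probE (x : nat -> pt) (w : nat -> 'I_4) z t :
  (forall n, psub (x n.+1) (x n) = dir (w n)) -> hit_prob p x z t = hit p w z t.
Proof.
move=> xw; rewrite -hitE; apply: eq_bigr => e _; apply: eq_bigr => i _.
by rewrite xw /step_prob /stp (inj_eq dir_inj).
Qed.

Lemma instructions_dir (x : nat -> pt) : instructions x ->
  exists w : nat -> 'I_4, forall n, psub (x n.+1) (x n) = dir (w n).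
Proof.
move=> [_ xP]; have H n : {e : 'I_4 | psub (x n.+1) (x n) = dir e}.
  by apply: cid; have /existsP[e /eqP] := xP n; exists e.
by exists (fun n => sval (H n)) => n; case: (H n).
Qed.

End Bridge.

(** * Infinite mean *)

Lemma nneseries_approx {R : realType} (u : nat -> R) (U eps : R) :
  (forall n, 0 <= u n) -> (\sum_(0 <= t <oo) (u t)%:E = U%:E)%E -> 0 < eps ->
  (forall n, \sum_(t < n) u t <= U) /\ exists n, U - eps < \sum_(t < n) u t.
Proof.
move=> u0 uU e0.
have part n : (\sum_(0 <= t < n) (u t)%:E)%E = (\sum_(t < n) u t)%:E.
  by rewrite big_mkord sumEFin.
split=> [n|].
  by rewrite -lee_fin -uU -part; apply: nneseries_lim_ge => k _ _; rewrite lee_fin.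
apply: contrapT => /forallNP H.
have : (\sum_(0 <= t <oo) (u t)%:E <= (U - eps)%:E)%E.
  apply: lime_le; first by apply: is_cvg_nneseries => k _ _; rewrite lee_fin.
  by apply: nearW => n; rewrite part lee_fin leNgt; apply/negP; exact: H.
by rewrite uU lee_fin; lra.
Qed.

(* If the mean U were finite, its tail beyond some N would be below d / 2, while
   t S t <= (tail beyond t) + t S M for every M, and S M tends to 0. *)
Lemma mean_infinite {R : realType} (h S : nat -> R) (d : R) :
  (forall t, 0 <= h t) -> (forall t, 0 <= S t) ->
  (forall t, S t + \sum_(s < t.+1) h s = 1) ->
  0 < d -> (forall N, exists2 t, (N <= t)%N & d <= t%:R * S t) ->
  (\sum_(0 <= t <oo) (t%:R * h t)%:E + +oo * (1%:E - \sum_(0 <= t <oo) (h t)%:E) = +oo)%E.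
Proof.
move=> h0 S0 hS d0 dS.
have th0 t : 0 <= t%:R * h t by rewrite mulr_ge0.
have mean0 : (0 <= \sum_(0 <= t <oo) (t%:R * h t)%:E)%E.
  by apply: nneseries_ge0 => t _ _; rewrite lee_fin.
have : (\sum_(0 <= t <oo) (h t)%:E <= 1)%E.
  apply: lime_le; first by apply: is_cvg_nneseries => k _ _; rewrite lee_fin.
  apply: nearW => n; rewrite big_mkord sumEFin lee_fin.
  case: n => [|n]; first by rewrite big_ord0.
  by rewrite -(hS n) lerDr.
(* If home is missed with positive probability, the second summand is already +oo. Otherwise it is
   +oo times 0, which is 0, and the series itself must diverge. *)
rewrite le_eqVlt => /predU1P[h1|h1]; last first.
  rewrite gt0_mulye ?sube_gt0 // addey //.
  by rewrite gt_eqF // (lt_le_trans _ mean0) // ltNye.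
rewrite h1 subee // mule0 adde0; apply: contrapT => mean_fin.
pose U := fine (\sum_(0 <= t <oo) (t%:R * h t)%:E)%E.
have UE : (\sum_(0 <= t <oo) (t%:R * h t)%:E = U%:E)%E.
  by rewrite fineK // ge0_fin_numE // lt_neqAle leey andbT; apply/eqP.
have d2 : 0 < d / 2 by rewrite divr_gt0.
have [Ule [N NU]] := nneseries_approx th0 UE d2.
have [t Nt dt] := dS N.+1.
have t0 : 0 < t%:R :> R by rewrite ltr0n; exact: leq_trans Nt.
have e0 : 0 < d / (2 * t%:R) by rewrite divr_gt0 ?mulr_gt0.
have [_ [M MS]] := nneseries_approx h0 h1 e0.
have hD n m : \sum_(s < n.+1 + m) h s = 1 - S n + \sum_(i < m) h (n.+1 + i)%N.
  by rewrite big_split_ord /= -(hS n) [S n + _]addrC addrK.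
have hD' n m : \sum_(s < n.+1 + m) s%:R * h s >=
    \sum_(s < n.+1) s%:R * h s + n%:R * \sum_(i < m) h (n.+1 + i)%N.
  rewrite big_split_ord /= lerD2l mulr_sumr; apply: ler_sum => i _.
  by rewrite ler_wpM2r // ler_nat addSn ltnW // ltnS leq_addr.
have NT : \sum_(s < N) s%:R * h s <= \sum_(s < t.+1) s%:R * h s.
  have /subnKC <- : (N <= t.+1)%N by rewrite ltnW // ltnW.
  by rewrite big_split_ord /= lerDl sumr_ge0.
have MT : \sum_(s < M) h s <= \sum_(s < t.+1 + M) h s.
  by rewrite addnC big_split_ord /= lerDl sumr_ge0.
have := Ule (t.+1 + M)%N; have := hD' t M; have := hD t M.
move: (\sum_(i < M) h (t.+1 + i)%N) => T hT h2 h3.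
have tT : t%:R * T < d / 2 by lra.
have ST : S t < T + d / (2 * t%:R) by lra.
have : t%:R * S t < t%:R * (T + d / (2 * t%:R)) by rewrite ltr_pM2l.
rewrite mulrDr (_ : t%:R * (d / (2 * t%:R)) = d / 2); first by lra.
by field; rewrite gt_eqF.
Qed.

Lemma prb_eventually_le {R : realType} (p c : R) : 0 < p -> p <= 1 ->
  2 / (pi * p * Num.sqrt (3 - 2 * p)) < c ->
  exists n0, forall n w z, (n0 < n)%N -> prb p w z n <= c / n%:R.
Proof.
move=> p0 p1; set c0 := _ / _ => cc.
have c00 : 0 < c0 by rewrite divr_gt0 ?mulr_gt0 ?pi_gt0 ?sqrtr_gt0 //; lra.
pose c' := (c0 + c) / 2.
have c0' : c0 < c' by rewrite /c'; lra.
have c'0 : 0 < c' by exact: lt_trans c0'.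
pose v := c0 / c'; have v1 : v < 1 by rewrite ltr_pdivrMr // mul1r.
have v0 : 0 < v by rewrite divr_gt0.
(* Since v = 1 - 2 eta is at most (1 - eta)^2, the main term c0 / (1 - eta)^2 is at most c'; the gap
   c - c' is left for the [kappa] term. *)
pose eta := (1 - v) / 2.
have eta0 : 0 < eta by rewrite /eta; lra.
have eta1 : eta < 1 by rewrite /eta; lra.
have [kappa H] := local_limit_upper p0 p1 eta0 eta1.
have ce : 0 < c - c' by rewrite /c'; lra.
exists (Num.trunc ((kappa / (c - c')) ^+ 2)) => n w z nn.
have n0 : (0 < n)%N by exact: leq_ltn_trans nn.
have nR : 0 < n%:R :> R by rewrite ltr0n.
rewrite ler_pdivlMr // mulrC; apply: le_trans (H n w z n0) _.
have -> : c = c' + (c - c') by ring.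
apply: lerD.
  rewrite invfM mulrA -/c0 ler_pdivrMr; last by rewrite exprn_gt0 // subr_gt0.
  have -> : c0 = c' * v by rewrite /v; field; rewrite gt_eqF.
  rewrite ler_pM2l //; have : 0 <= eta ^+ 2 by exact: sqr_ge0.
  by rewrite /eta; lra.
rewrite ler_pdivrMr ?sqrtr_gt0 // -ler_pdivrMl // mulrC.
apply: le_trans (ler_norm _) _; rewrite -sqrtr_sqr ler_sqrt //.
by apply/ltW/(lt_le_trans (truncnS_gt _)); rewrite ler_nat.
Qed.

Theorem theorem1 (R : realType) (p1 p : R) :
  0 < p1 < 1 ->
  pi * p1 * Num.sqrt (3 - 2 * p1) * Rpoly p1 = 4 ->
  p1 < p <= 1 ->
  forall (home : pt), home != origin ->
  forall (x : nat -> pt), instructions x ->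
  expected_hitting_time p x home = +oo%E.
Proof.
move=> /andP[p10 _] p1E /andP[p1p ple] home home0 x /instructions_dir[w xw].
have p0 : 0 < p by exact: lt_trans p1p.
have Rp := threshold_gt p10 p1p ple p1E.
have P0 : 0 < pi * p * Num.sqrt (3 - 2 * p).
  by rewrite !mulr_gt0 ?pi_gt0 ?sqrtr_gt0 //; lra.
have lt : 2 / (pi * p * Num.sqrt (3 - 2 * p)) < Rpoly p / 2.
  by rewrite ltr_pdivrMr //; move: Rp; lra.
(* The midpoint serves as [c]: above the local limit constant, below half of [Rpoly p]. *)
have [n0 le] := prb_eventually_le p0 ple (midf_lt lt).1.
have [d d0 dS] := survival_lower_bound p0 ple (midf_lt lt).2 le w home0.
rewrite /expected_hitting_time.
under eq_eseriesr do rewrite (hit_probE _ _ _ xw).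
under [X in (_ - X)%E]eq_eseriesr do rewrite (hit_probE _ _ _ xw).
apply: mean_infinite d0 dS => t; [exact: hit_ge0 | exact: surv_ge0 | exact: sum_hit].
Qed.
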